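(* Let $t$ be an integer, and let $f_{1} = (2863 + 10764t)/13$ and $f_{2} = (1207 + 26455t)/13$. Then $f_{1}^{6} + f_{2}^{6}$ is an integer that is a sum of two rational sixth powers, but not a sum of two integer sixth powers.
   Context: An integer $k$ is a sum of two rational (respectively integer) sixth powers if $k = a^{6} + b^{6}$ for some $a, b \in \mathbb{Q}$ (respectively $a, b \in \mathbb{Z}$); zero is allowed as a value of $a$ or $b$. *)

(* Defs.v *)
From Stdlib Require Import ZArith QArith.

(* Equality of rationals is [Qeq] ([==]); exponents of [Qpower] and [Z.pow]
   are elements of [Z]. *)

Definition sum_of_two_rational_sixth_powers (k : Z) : Prop :=
  exists a b : Q, (inject_Z k == a ^ 6 + b ^ 6)%Q.

Definition sum_of_two_integer_sixth_powers (k : Z) : Prop :=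
  exists a b : Z, (k = a ^ 6 + b ^ 6)%Z.

(* Main.v *)
Require Import Defs.
From Stdlib Require Import ZArith QArith Qpower Lia Morphisms.

(** Write [x = 2863 + 10764 t] and [y = 1207 + 26455 t] for the numerators.
    In the Gaussian integers
    [x + i y = (828 + 2035 i) ((1 + 13 t) - i)], and
    [828^2 + 2035^2 = 13^6] because [828 + 2035 i] is, up to a unit, the sixth
    power of a prime above 13. Taking norms,
    [x^2 + y^2 = 13^6 ((1 + 13 t)^2 + 1)].
    Since [x^6 + y^6 = (x^2 + y^2) (x^4 - x^2 y^2 + y^4)], the first factor
    absorbs the whole denominator [13^6] of [f1^6 + f2^6], and
    [((1 + 13 t)^2 + 1) (x^4 - x^2 y^2 + y^4)] is the integer sought; it is a
    sum of two rational sixth powers by construction.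

    The obstruction to integer sixth powers is modulo 13. As 13 divides both
    10764 and 26455, the residue of that integer does not depend on [t]: it
    is 5. A sixth power is 0, 1 or -1 modulo 13, so a sum of two of them is
    never 5. *)

Lemma sum_of_sixth_powers_factor (x y : Z) :
  (x ^ 6 + y ^ 6 = (x ^ 2 + y ^ 2) * (x ^ 4 - x ^ 2 * y ^ 2 + y ^ 4))%Z.
Proof. ring. Qed.

#[local] Existing Instances eqm_setoid Zplus_eqm Zminus_eqm Zmult_eqm.

#[local] Instance Zpow_eqm (N : Z) : Proper (eqm N ==> eq ==> eqm N) Z.pow.
Proof.
  intros a b Hab n _ <-; unfold eqm in *.
  now rewrite <- (Z.mod_pow_l a), Hab, Z.mod_pow_l.
Qed.

(** Euler's criterion for the prime 13: the sixth power of a unit is its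
    quadratic character. *)
Lemma sixth_power_mod_13 (a : Z) :
  (a ^ 6 mod 13 = 0 \/ a ^ 6 mod 13 = 1 \/ a ^ 6 mod 13 = 12)%Z.
Proof.
  rewrite <- Z.mod_pow_l.
  assert (H : (0 <= a mod 13 < 13)%Z) by (apply Z.mod_pos_bound; lia).
  set (r := (a mod 13)%Z) in *; clearbody r.
  assert (r = 0 \/ r = 1 \/ r = 2 \/ r = 3 \/ r = 4 \/ r = 5 \/ r = 6 \/
          r = 7 \/ r = 8 \/ r = 9 \/ r = 10 \/ r = 11 \/ r = 12)%Z as Hr by lia.
  repeat (destruct Hr as [-> | Hr]; [vm_compute; tauto |]).
  subst r; vm_compute; tauto.
Qed.

Lemma five_mod_13_not_sum_of_two_integer_sixth_powers (k : Z) :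
  (k mod 13 = 5)%Z -> ~ sum_of_two_integer_sixth_powers k.
Proof.
  intros Hk (a & b & ->).
  rewrite Z.add_mod in Hk by lia.
  destruct (sixth_power_mod_13 a) as [Ha | [Ha | Ha]];
    destruct (sixth_power_mod_13 b) as [Hb | [Hb | Hb]];
    rewrite Ha, Hb in Hk; discriminate Hk.
Qed.

Lemma sixth_powers_over_common_denominator (x y k : Z) (d : positive) :
  (x ^ 6 + y ^ 6 = k * Z.pos d ^ 6)%Z ->
  ((inject_Z x / inject_Z (Z.pos d)) ^ 6 +
   (inject_Z y / inject_Z (Z.pos d)) ^ 6 == inject_Z k)%Q.
Proof.
  intros H.
  assert (HQ : (inject_Z x ^ 6 + inject_Z y ^ 6
                == inject_Z k * inject_Z (Z.pos d) ^ 6)%Q).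
  { rewrite <- !Zpower_Qpower by lia.
    now rewrite <- inject_Z_plus, <- inject_Z_mult, H. }
  assert (Hd : ~ (inject_Z (Z.pos d) == 0)%Q) by discriminate.
  transitivity ((inject_Z x ^ 6 + inject_Z y ^ 6)
                / inject_Z (Z.pos d) ^ 6)%Q.
  - field. exact Hd.
  - rewrite HQ. field. exact Hd.
Qed.

Theorem theorem2 (t : Z) :
  let f1 : Q := ((2863 + 10764 * inject_Z t) / 13)%Q in
  let f2 : Q := ((1207 + 26455 * inject_Z t) / 13)%Q in
  exists k : Z,
    (f1 ^ 6 + f2 ^ 6 == inject_Z k)%Q /\
    sum_of_two_rational_sixth_powers k /\
    ~ sum_of_two_integer_sixth_powers k.
Proof.
  intros f1 f2.
  set (x := (2863 + 10764 * t)%Z).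
  set (y := (1207 + 26455 * t)%Z).
  set (k := (((1 + 13 * t) ^ 2 + 1) * (x ^ 4 - x ^ 2 * y ^ 2 + y ^ 4))%Z).
  assert (Hk : (f1 ^ 6 + f2 ^ 6 == inject_Z k)%Q).
  { assert (H1 : (f1 == inject_Z x / inject_Z 13)%Q)
      by (unfold f1, x; now rewrite inject_Z_plus, inject_Z_mult).
    assert (H2 : (f2 == inject_Z y / inject_Z 13)%Q)
      by (unfold f2, y; now rewrite inject_Z_plus, inject_Z_mult).
    rewrite H1, H2.
    apply sixth_powers_over_common_denominator.
    rewrite sum_of_sixth_powers_factor.
    assert (Hnorm : (x ^ 2 + y ^ 2 = ((1 + 13 * t) ^ 2 + 1) * 13 ^ 6)%Z)
      by (unfold x, y; ring).
    rewrite Hnorm. unfold k. ring. }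
  exists k. split; [exact Hk | split].
  - exists f1, f2. now symmetry.
  - apply five_mod_13_not_sum_of_two_integer_sixth_powers.
    assert (Hx : eqm 13 x 3) by
      (unfold x; replace (2863 + 10764 * t)%Z with (3 + (220 + 828 * t) * 13)%Z
         by ring; apply Z.mod_add; discriminate).
    assert (Hy : eqm 13 y (-2)) by
      (unfold y; replace (1207 + 26455 * t)%Z with (-2 + (93 + 2035 * t) * 13)%Z
         by ring; apply Z.mod_add; discriminate).
    assert (Hs : eqm 13 (1 + 13 * t) 1)
      by (rewrite (Z.mul_comm 13 t); apply Z.mod_add; discriminate).
    clearbody x y. unfold k. clear k Hk.
    change (eqm 13 (((1 + 13 * t) ^ 2 + 1) * (x ^ 4 - x ^ 2 * y ^ 2 + y ^ 4)) 5).
    setoid_rewrite Hx; setoid_rewrite Hy; setoid_rewrite Hs. reflexivity.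
Qed.
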